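(* Let $(p_n)_{n\ge 1}$ be a sequence in $[0,1]$ with $p_n = \frac1n + O(n^{-4/3})$ as $n\to\infty$, and write $p=p_n$. Let $\mathcal L(\vec G(n,p))$ denote the maximal length of a saop in $\vec G(n,p)$. Then, as $n\to\infty$, $\mathcal L(\vec G(n,p)) = O_{\mathbb P}(n^{1/3})$.
   Context: For $n\ge 1$ and $p\in[0,1]$, $\vec G(n,p)$ is the random directed graph on the vertex set $\{1,2,\dots,n\}$ in which each of the $n(n-1)$ possible directed edges $(u,v)$, $u\ne v$, is independently present with probability $p$. A saop (self-avoiding oriented path) of length $k$ in a directed graph $\vec G$ is a sequence of vertices $(v_0,v_1,\dots,v_k)$ such that the oriented edges $(v_0,v_1),\dots,(v_{k-1},v_k)$ are pairwise different and all belong to $\vec G$ (a single vertex is a saop of length $0$). For a sequence $(X_n)$ of real random variables and a positive function $f$ on the positive integers, $X_n=O_{\mathbb P}(f(n))$ means that the sequence $(X_n/f(n))_n$ is tight. *)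

(* Defs.v *)
From HB Require Import structures.
From mathcomp Require Import all_boot all_order all_algebra.
From mathcomp Require Import all_classical all_reals all_analysis.
Set Implicit Arguments.
Unset Strict Implicit.
Unset Printing Implicit Defensive.
Import Order.TTheory GRing.Theory Num.Theory.
Import numFieldNormedType.Exports.
Local Open Scope classical_set_scope.
Local Open Scope ring_scope.

(* A directed graph on n labelled vertices, given by its set of edges; (u, v)
   is the edge from u to v. *)
Definition digraph (n : nat) := {set 'I_n * 'I_n}.

Section Saop.
Variable n : nat.
Implicit Types (g : digraph n) (v : 'I_n) (s : seq 'I_n).

(* The vertex sequence (v_0, ..., v_k) is given by its head v = v_0 and its
   tail s = [:: v_1; ...; v_k], so that its length k is size s. *)
Definition arcs v s : seq ('I_n * 'I_n) := zip (v :: s) s.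

(* Only edges, not vertices, are required to be pairwise different. *)
Definition saop g v s : bool := uniq (arcs v s) && all (mem g) (arcs v s).

(* A saop of g uses pairwise different edges of g, so its length is at most
   #|g|: see longest_saop_ge and longest_saop_attained. *)
Definition longest_saop g : nat :=
  (\max_(k < #|g|.+1 | [exists v, exists s : k.-tuple 'I_n, saop g v s]) k)%N.

Lemma size_arcs v s : size (arcs v s) = size s.
Proof. by rewrite size2_zip //=. Qed.

Lemma saop_size g v s : saop g v s -> (size s <= #|g|)%N.
Proof.
move=> /andP[us /allP sg]; rewrite -(size_arcs v) cardE.
by apply: uniq_leq_size => // e /sg eg; rewrite mem_enum.
Qed.

Lemma longest_saop_ge g v s : saop g v s -> (size s <= longest_saop g)%N.
Proof.
move=> gs; have sg : (size s < #|g|.+1)%N by rewrite ltnS; exact: saop_size gs.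
apply: (@leq_bigmax_cond _ _ (@nat_of_ord _) (Ordinal sg)).
by apply/existsP; exists v; apply/existsP; exists (in_tuple s).
Qed.

Lemma longest_saop_attained g : (0 < n)%N ->
  exists v s, saop g v s /\ size s = longest_saop g.
Proof.
move=> n0; rewrite /longest_saop.
have P0 : [exists v, exists s : (@ord0 #|g|).-tuple 'I_n, saop g v s].
  by apply/existsP; exists (Ordinal n0); apply/existsP; exists [tuple].
rewrite (bigop.bigmax_eq_arg ord0) //.
case: arg_maxnP => // k /existsP[v /existsP[s gs]] _.
by exists v, s; rewrite size_tuple.
Qed.

End Saop.

Section Probability.
Context {d : measure_display} {T : measurableType d} {R : realType}.
Variable P : probability T R.

Definition independent_events (I : finType) (D : {set I}) (E : I -> set T) :=
  (forall i, i \in D -> measurable (E i)) /\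
  (forall J : {set I}, J \subset D ->
     P (\bigcap_(i in [set` J]) E i) = (\prod_(i in J) P (E i))%E).

Definition possible_edges (n : nat) : {set 'I_n * 'I_n} :=
  [set e | e.1 != e.2]%SET.

(* G is a random directed graph, on the probability space (T, P), with the
   law of the binomial random digraph of parameters n and p. *)
Definition is_binomial_digraph (n : nat) (p : R) (G : T -> digraph n) :=
  [/\ forall w, G w \subset possible_edges n,
      forall e, e \in possible_edges n -> P [set w | e \in G w] = p%:E &
      independent_events (possible_edges n) (fun e => [set w | e \in G w])].

(* In particular every probability below is that of a measurable set. *)
Lemma measurable_binomial_digraph (n : nat) (p : R) (G : T -> digraph n)
    (Q : set (digraph n)) :
  is_binomial_digraph p G -> measurable [set w | Q (G w)].
Proof.
move=> [Gsub _ [mG _]].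
have mE e : measurable [set w | e \in G w].
  have [/mG//|eN] := boolP (e \in possible_edges n).
  suff -> : [set w | e \in G w] = set0 by exact: measurable0.
  apply/seteqP; split => // w /= eG.
  by move: eN; rewrite (fintype.subsetP (Gsub w)).
have -> : [set w | Q (G w)] = \bigcup_(g in Q) \bigcap_(e in [set: 'I_n * 'I_n])
    [set w | (e \in G w) = (e \in g)].
  apply/seteqP; split => w /=; first by move=> QG; exists (G w).
  by move=> [g Qg wg]; suff -> : G w = g by []; apply/setP => e; exact: wg.
apply: fin_bigcup_measurable; first exact: finite_finset.
move=> g _; apply: fin_bigcap_measurable; first exact: finite_finset.
move=> e _; case: (e \in g); first exact: mE.
rewrite (_ : [set w | _] = ~` [set w | e \in G w]); first exact/measurableC/mE.
by apply/seteqP; split => w /= => [->//|/negP/negbTE].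
Qed.

End Probability.

Section Tightness.
Context {R : realType} {d : nat -> measure_display}
  {T : forall n, measurableType (d n)}.
Variable P : forall n, probability (T n) R.

(* Sequences are indexed by the positive integers: the term of index 0 is
   ignored. The n-th variable may live on its own probability space. *)
Definition tight (X : forall n, T n -> R) :=
  forall eps : R, 0 < eps -> exists M : R, forall n, (0 < n)%N ->
    (P n [set w | (M < `|X n w|)%R] <= eps%:E)%E.

Definition bigO_in_probability (X : forall n, T n -> R) (f : nat -> R) :=
  tight (fun n w => X n w / f n).

End Tightness.

(* Main.v *)
(* If some saop has length 2k + m, then each of its m middle edges (u, v) occurs
   disjointly from a trail of length k ending at u and from a trail of length k
   starting at v. By the van den Berg-Kesten inequality this has probability at
   most p q_k^2, where q_k bounds the probability that a trail of length k
   starts at a given vertex. A trail uses each edge at most once, so giving the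
   branches of the tree of trails independent copies of the edges can only
   increase that probability; hence q_k can be taken to be the survival
   probability to generation k of a binomial(n, p) Galton-Watson process, which
   is O(1/k) as long as k = O(n^(1/3)). With k of order n^(1/3) and m of order
   A n^(1/3), Markov's inequality applied to the number of middle edges bounds
   the probability of such a saop by n^2 p q_k^2 / m = O(1/A). *)
Require Import Defs.
From HB Require Import structures.
From mathcomp Require Import all_classical all_reals all_analysis.
From mathcomp Require Import all_boot all_order all_algebra.
From mathcomp Require Import ring lra.
Set Implicit Arguments.
Unset Strict Implicit.
Unset Printing Implicit Defensive.
Import Order.TTheory GRing.Theory Num.Theory.
Import numFieldNormedType.Exports.
Local Open Scope ring_scope.

(** * Expectation over random edge sets and the van den Berg-Kesten inequality *)

Section Mean.
Variables (R : realFieldType) (E : finType) (p : R).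
Hypothesis p01 : 0 <= p <= 1.
Implicit Types (s : seq E) (f h : {set E} -> R).

(* Expectation of [f] at the random subset of [s] that contains each element
   independently with probability [p]. *)
Fixpoint mean s f : R :=
  if s is e :: s' then (1 - p) * mean s' f + p * mean s' (fun g => f (e |: g)%SET)
  else f set0%SET.

Lemma mean_le s f h :
  (forall g : {set E}, {subset g <= s} -> f g <= h g) -> mean s f <= mean s h.
Proof.
have /andP[p0 p1] := p01.
elim: s f h => [|e s IHs] f h fh /=.
  by apply: fh => x; rewrite inE.
apply: lerD; apply: ler_wpM2l; rewrite ?subr_ge0 //; apply: IHs => g gs; apply: fh => x.
  by move/gs => xs; rewrite inE xs orbT.
by rewrite in_setU1 inE => /orP[->//|/gs->]; rewrite orbT.
Qed.

Lemma eq_mean s f h : f =1 h -> mean s f = mean s h.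
Proof.
elim: s f h => [|e s IHs] f h fh /=; first exact: fh.
by rewrite (IHs _ _ fh); congr (_ + p * _); apply: IHs => g; exact: fh.
Qed.

Lemma meanD s f h : mean s (fun g => f g + h g) = mean s f + mean s h.
Proof. by elim: s f h => //= e s IHs f h; rewrite !IHs; ring. Qed.

Lemma meanZ s c f : mean s (fun g => c * f g) = c * mean s f.
Proof. by elim: s f => //= e s IHs f; rewrite !IHs; ring. Qed.

Lemma mean_cst s c : mean s (fun=> c) = c.
Proof. by elim: s => //= e s ->; ring. Qed.

Lemma mean_sum s (I : finType) (D : pred I) (F : I -> {set E} -> R) :
  mean s (fun g => \sum_(i | D i) F i g) = \sum_(i | D i) mean s (F i).
Proof.
elim: s F => //= e s IHs F.
by rewrite !IHs !big_distrr /= -big_split.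
Qed.

Lemma mean_ge0 s f : (forall g, 0 <= f g) -> 0 <= mean s f.
Proof. by move=> f0; rewrite -(mean_cst s 0); apply: mean_le => g _. Qed.

Lemma mean_mem s e : uniq s -> e \in s -> mean s (fun g => (e \in g)%:R) = p.
Proof.
have meanN y s' : y \notin s' -> mean s' (fun g => (y \in g)%:R) = 0.
  elim: s' => [_|x s' IHs]/=; first by rewrite inE.
  rewrite inE negb_or => /andP[/negbTE yx ys'].
  under [X in _ + p * X]eq_mean => g do rewrite in_setU1 yx /=.
  by rewrite IHs // !mulr0 addr0.
elim: s => //= x s IHs /andP[xs us]; rewrite inE => /predU1P[->|es].
  under [X in _ + p * X]eq_mean => g do rewrite setU11.
  by rewrite meanN // mean_cst mulr0 add0r mulr1.
have /negbTE ex : e != x by apply: contraNneq xs => <-.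
under [X in _ + p * X]eq_mean => g do rewrite in_setU1 ex /=.
by rewrite IHs //; ring.
Qed.

Definition increasing (A : pred {set E}) :=
  forall g h : {set E}, g \subset h -> A g -> A h.

(** An arbitrary relation [Q] between the two disjoint witnesses is allowed because product
    relations [A a && B b] are not stable under the induction that proves the inequality. *)
Definition splits (Q : {set E} -> pred {set E}) : pred {set E} := fun g =>
  [exists a : {set E}, exists b : {set E},
     [&& [disjoint a & b], a :|: b \subset g & Q a b]].

Definition disjoint_occurrence (A B : pred {set E}) :=
  splits (fun a b => A a && B b).

(* The elements of [s] are split one at a time into two independent copies, one
   for each argument of [Q]. *)
Lemma splits_le_mean s (Q : {set E} -> pred {set E}) : uniq s ->
  (forall a a' b b' : {set E}, a \subset a' -> b \subset b' -> Q a b -> Q a' b') ->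
  mean s (fun g => (splits Q g)%:R) <=
  mean s (fun a => mean s (fun b => (Q a b)%:R)).
Proof.
have /andP[p0 p1] := p01.
elim: s Q => [|e s IHs] Q /=.
  move=> _ Qmon; rewrite ler_nat; case: (boolP (splits _ _)) => // /existsP[a /existsP[b]].
  move=> /and3P[_ ab0 Qab]; rewrite (Qmon _ _ _ _ _ _ Qab) //.
    exact: subset_trans (subsetUl _ _) ab0.
  exact: subset_trans (subsetUr _ _) ab0.
move=> /andP[es us] Qmon.
(* When [e] is present, disjointness lets it serve only one of the two witnesses. *)
pose Q1 a b := Q (e |: a)%SET b || Q a (e |: b)%SET.
have Q1mon (a a' b b' : {set E}) :
    a \subset a' -> b \subset b' -> Q1 a b -> Q1 a' b'.
  move=> aa' bb' /orP[] Qab; apply/orP; [left|right];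
    by apply: Qmon Qab => //; apply: setUS.
have Q1split (g : {set E}) : {subset g <= s} -> splits Q (e |: g)%SET -> splits Q1 g.
  move=> gs /existsP[a /existsP[b /and3P[dab abg Qab]]].
  apply/existsP; exists (a :\ e)%SET; apply/existsP; exists (b :\ e)%SET.
  apply/and3P; split.
  - apply: disjointWl (subsetDl _ _) _; apply: disjointWr dab; exact: subsetDl.
  - apply/fintype.subsetP => x; rewrite -setDUl in_setD1 => /andP[xe xab].
    by have := fintype.subsetP abg x xab; rewrite in_setU1 (negbTE xe).
  - apply/orP; have [ea|ea] := boolP (e \in a).
      left; apply: Qmon Qab; first by rewrite setD1K.
      have eb : e \notin b by rewrite (disjointFr dab ea).
      by apply/fintype.subsetP => x xb; rewrite in_setD1 xb andbT; apply: contraNneq eb => <-.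
    right; apply: Qmon Qab.
      by apply/fintype.subsetP => x xb; rewrite in_setD1 xb andbT; apply: contraNneq ea => <-.
    by apply/fintype.subsetP => x xb; rewrite in_setU1 in_setD1 xb andbT; case: eqP.
have leI (f h : {set E} -> {set E} -> R) :
   (forall a b, f a b <= h a b) ->
   mean s (fun a => mean s (f a)) <= mean s (fun a => mean s (h a)).
  by move=> fh; apply: mean_le => a _; apply: mean_le => b _.
apply: (@le_trans _ _ (mean s (fun a => mean s (fun b =>
    (1 - p) * (Q a b)%:R + p * (Q1 a b)%:R)))).
  under [leRHS]eq_mean do rewrite meanD !meanZ.
  rewrite meanD !meanZ; apply: lerD; apply: ler_wpM2l; rewrite ?subr_ge0 //.
    exact: IHs.
  apply: le_trans (IHs Q1 us Q1mon); apply: mean_le => g gs.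
  by rewrite ler_nat; case: (boolP (splits Q _)) => // /Q1split ->.
rewrite -!meanZ -meanD.
under [leRHS]eq_mean do rewrite -!meanZ -!meanD -!meanZ -meanD.
(* Pointwise comparison for fixed [a] and [b]. If [Q a b] holds, both sides are 1. If only [Q1 a b]
   holds, the left side is p and the right side is at least p(1-p) + p^2 = p. *)
apply: leI => a b.
have h1 : Q a b -> Q (e |: a)%SET b by apply: Qmon => //; exact: subsetUr.
have h2 : Q a b -> Q a (e |: b)%SET by apply: Qmon => //; exact: subsetUr.
have h3 : Q (e |: a)%SET b -> Q (e |: a)%SET (e |: b)%SET.
  by apply: Qmon => //; exact: subsetUr.
have h4 : Q a (e |: b)%SET -> Q (e |: a)%SET (e |: b)%SET.
  by apply: Qmon => //; exact: subsetUr.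
rewrite /Q1.
move: h1 h2 h3 h4; case: (Q a b); case: (Q _ b); case: (Q a _); case: (Q _ _) => /=;
  do ?[by move=> /(_ isT) | by move=> _ /(_ isT) | by move=> _ _ /(_ isT) | by move=> _ _ _ /(_ isT)];
  move=> *; nra.
Qed.

Lemma disjoint_occurrence_increasing A B : increasing (disjoint_occurrence A B).
Proof.
move=> g h gh /existsP[a /existsP[b /and3P[dab abg AB]]].
apply/existsP; exists a; apply/existsP; exists b; apply/and3P; split=> //.
exact: subset_trans abg gh.
Qed.

(* The van den Berg-Kesten inequality. *)
Lemma mean_disjoint_occurrence s A B : uniq s -> increasing A -> increasing B ->
  mean s (fun g => (disjoint_occurrence A B g)%:R) <=
  mean s (fun g => (A g)%:R) * mean s (fun g => (B g)%:R).
Proof.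
move=> us Ai Bi; apply: le_trans (splits_le_mean us _) _.
  by move=> a a' b b' aa' bb' /andP[Aa Bb]; rewrite (Ai _ _ aa') //= (Bi _ _ bb').
rewrite mulrC -meanZ; apply: mean_le => a _.
rewrite [leRHS]mulrC -meanZ; apply: mean_le => b _.
by rewrite -mulnb natrM.
Qed.

End Mean.

(** * Trails compared with a branching process *)

Section Survival.
Variables (R : realFieldType) (V E : finType) (arc : V -> V -> E).
Implicit Types (w : E -> R) (s : seq V) (used : seq E).

(** The labelling [arc] is a parameter so that one argument covers both trails leaving [v] and
    trails arriving at [v], read backwards. *)
Fixpoint labels v s : seq E :=
  if s is x :: s' then arc v x :: labels x s' else [::].

Definition walk k v : pred {set E} := fun g =>
  [exists s : k.-tuple V, uniq (labels v s) && all (mem g) (labels v s)].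

Lemma labels_take v s k : labels v (take k s) = take k (labels v s).
Proof. by elim: s v k => [|x s IHs] v [|k] //=; rewrite IHs. Qed.

Lemma walkP k v (g : {set E}) s : (k <= size s)%N -> uniq (labels v s) ->
  {subset labels v s <= g} -> walk k v g.
Proof.
move=> ks us sg; apply/existsP.
have st : size (take k s) == k by rewrite size_takel.
exists (Tuple st); rewrite /= labels_take take_uniq //=.
by apply/allP => e /mem_take; exact: sg.
Qed.

Lemma walk_increasing k v : increasing (walk k v).
Proof.
move=> g h gh /existsP[s /andP[us /allP sg]]; apply/existsP; exists s.
by rewrite us; apply/allP => e /sg; exact: (fintype.subsetP gh).
Qed.

(* Survival to generation k of the percolation on the tree of trails from v
   avoiding [used], where a trail meets each weight at most once but distinct
   branches see independent copies of the same edge. *)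
Fixpoint surv w k used v : R :=
  if k is k'.+1 then
    1 - \prod_(x | arc v x \notin used)
          (1 - w (arc v x) * surv w k' (arc v x :: used) x)
  else 1.

Definition upd w e t : E -> R := fun e' => if e' == e then t else w e'.

Lemma surv01 w k used v : (forall e, 0 <= w e <= 1) -> 0 <= surv w k used v <= 1.
Proof.
move=> w01; elim: k used v => [|k IHk] used v /=; first by rewrite ler01 lexx.
suff /andP[] : 0 <= \prod_(x | arc v x \notin used)
  (1 - w (arc v x) * surv w k (arc v x :: used) x) <= 1 by move=> *; lra.
have f01 x : 0 <= 1 - w (arc v x) * surv w k (arc v x :: used) x <= 1.
  by move: (w01 (arc v x)) (IHk (arc v x :: used) x) => /andP[? ?] /andP[? ?]; nra.
by rewrite prodr_ge0 ?prodr_ile1 // => x _; case/andP: (f01 x).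
Qed.

Lemma eq_surv w w' k used v : w =1 w' -> surv w k used v = surv w' k used v.
Proof.
move=> ww'; elim: k used v => [//|k IHk] used v /=.
by congr (1 - _); apply: eq_bigr => x _; rewrite ww' IHk.
Qed.

(** The recursion never reads the weight of an edge already on the trail, so below a child reached
    by [e] the weight of [e] no longer matters. *)
Lemma surv_upd_used w k used v e t :
  e \in used -> surv (upd w e t) k used v = surv w k used v.
Proof.
elim: k used v => [//|k IHk] used v eu /=; congr (1 - _); apply: eq_bigr => x xu.
rewrite IHk; last by rewrite inE eu orbT.
by rewrite /upd; case: eqP => // xe; rewrite xe eu in xu.
Qed.

(** Multiplying two chord bounds leaves the cross term t(1-t)(a0-a1)(y0-y1), nonnegative because
    factors and partial products both decrease from the 0-end to the 1-end. The other conclusions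
    are carried along for this step. *)
Lemma prod_convex (t : R) (I : finType) (Q : pred I) (a a0 a1 : I -> R) : 0 <= t <= 1 ->
  (forall i, Q i -> [/\ 0 <= a1 i, a1 i <= a0 i, 0 <= a i &
     a i <= (1 - t) * a0 i + t * a1 i]) ->
  [/\ 0 <= \prod_(i | Q i) a1 i, \prod_(i | Q i) a1 i <= \prod_(i | Q i) a0 i,
      0 <= \prod_(i | Q i) a i &
      \prod_(i | Q i) a i <=
      (1 - t) * \prod_(i | Q i) a0 i + t * \prod_(i | Q i) a1 i].
Proof.
move=> /andP[t0 t1] aP.
elim/big_rec3: _ => [|i y y0 y1 Qi [y10 y101 yge0 yle]]; first by split => //; lra.
have [b1 b10 b bl] := aP i Qi.
split; [exact: mulr_ge0 | exact: ler_pM | exact: mulr_ge0 |].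
apply: (le_trans (ler_pM b yge0 bl yle)).
have : 0 <= t * (1 - t) * ((a0 i - a1 i) * (y0 - y1)).
  by do ![apply: mulr_ge0 => //]; rewrite subr_ge0.
by move=> ?; lra.
Qed.

(** Extinction is a product over children. A factor whose arc is [e] is affine in [w e]; the others
    are handled by induction, and [prod_convex] combines them. It needs monotonicity, hence the
    conjunction. *)
Lemma surv_concave w k used v e : (forall e', 0 <= w e' <= 1) ->
  surv (upd w e 0) k used v <= surv (upd w e 1) k used v /\
  (1 - w e) * surv (upd w e 0) k used v + w e * surv (upd w e 1) k used v <=
    surv w k used v.
Proof.
move=> w01; have upd01 t : 0 <= t <= 1 -> forall e', 0 <= upd w e t e' <= 1.
  by move=> ht e'; rewrite /upd; case: eqP.
have u0 := upd01 0 (introT andP (conj (lexx 0) ler01)).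
have u1 := upd01 1 (introT andP (conj ler01 (lexx 1))).
elim: k used v => [|k IHk] used v /=; first by split => //; lra.
set Q := fun x => arc v x \notin used.
pose a w' x := 1 - w' (arc v x) * surv w' k (arc v x :: used) x.
have [||_ le10 _ le] := @prod_convex (w e) _ Q (a w) (a (upd w e 0)) (a (upd w e 1)).
- exact: w01.
- move=> x Qx; rewrite /a.
  have [/eqP xe|xe] := boolP (arc v x == e).
    rewrite xe !surv_upd_used ?mem_head // /upd eqxx.
    have /andP[? ?] := surv01 k (e :: used) x w01; have /andP[? ?] := w01 e.
    by split; nra.
  have -> : upd w e 0 (arc v x) = w (arc v x) by rewrite /upd (negbTE xe).
  have -> : upd w e 1 (arc v x) = w (arc v x) by rewrite /upd (negbTE xe).
  have [h1 h2] := IHk (arc v x :: used) x.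
  have /andP[? ?] := surv01 k (arc v x :: used) x w01.
  have /andP[? ?] := surv01 k (arc v x :: used) x u0.
  have /andP[? ?] := surv01 k (arc v x :: used) x u1.
  have /andP[? ?] := w01 (arc v x).
  have h3 := ler_wpM2l (_ : 0 <= w (arc v x)) h2.
  by split; nra.
- by split; rewrite /a in le10 le *; lra.
Qed.

Lemma walk_surv w k used v s : (k <= size s)%N -> (forall e, 0 <= w e <= 1) ->
  uniq (labels v s) -> {in labels v s, forall e, e \notin used /\ w e = 1} ->
  surv w k used v = 1.
Proof.
move=> + w01; elim: k used v s => [//|k IHk] used v [|x s] //= ks /andP[xs us] wP.
have [xu wx] := wP _ (mem_head _ _).
rewrite (bigD1 x) //= wx (IHk _ _ s) // ?mulr1 ?subrr ?mul0r ?subr0 //.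
move=> e es; have [eu we] := wP e (mem_behead (s := _ :: _) es).
by rewrite inE negb_or eu andbT; split => //; apply: contraNneq xs => <-.
Qed.

(* Survival to generation [k] of the binomial(n, p) Galton-Watson process. *)
Fixpoint survival_bound (p : R) (n k : nat) : R :=
  if k is k'.+1 then 1 - (1 - p * survival_bound p n k') ^+ n else 1.

Lemma survival_bound01 p n k : 0 <= p <= 1 -> 0 <= survival_bound p n k <= 1.
Proof.
move=> /andP[p0 p1]; elim: k => [|k /andP[q0 q1]] /=; first by rewrite ler01 lexx.
have pq : 0 <= 1 - p * survival_bound p n k <= 1 by apply/andP; nra.
have /andP[pq0 pq1] := pq.
by rewrite subr_ge0 exprn_ile1 //= gerBl exprn_ge0.
Qed.

Lemma surv_le p w k used v : 0 <= p <= 1 -> (forall e, 0 <= w e <= p) ->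
  surv w k used v <= survival_bound p #|V| k.
Proof.
move=> p01 wp; elim: k used v => [//|k IHk] used v /=; rewrite lerD2l lerN2.
have /andP[p0 p1] := p01.
rewrite -prodr_const big_mkcond [leRHS]big_mkcond /=.
have /andP[b0 b1] := survival_bound01 #|V| k p01.
have w01 e : 0 <= w e <= 1 by have /andP[-> /le_trans->] := wp e.
apply: ler_prod => x _.
have /andP[? ?] := surv01 k (arc v x :: used) x w01.
have /andP[? ?] := wp (arc v x).
have h := IHk (arc v x :: used) x.
by apply/andP; case: ifP => _; split; nra.
Qed.

(* [surv] is concave in each weight, so revealing the edges one at a time (as
   weights 0 or 1) decreases its mean. *)
Lemma mean_walk p (s : seq E) k v : 0 <= p <= 1 -> uniq s ->
  mean p s (fun g => (walk k v g)%:R) <= survival_bound p #|V| k.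
Proof.
move=> p01 us; have /andP[p0 p1] := p01.
(* Edges of [r] are still hidden and keep weight p; [J] collects the edges revealed as present. *)
pose wt (r : seq E) (J : {set E}) e : R := if e \in r then p else (e \in J)%:R.
have wt01 (r : seq E) J e : 0 <= wt r J e <= 1.
  by rewrite /wt; case: ifP => // _; case: (e \in J); rewrite ?ler01 lexx.
suff main (J : {set E}) : {in s, forall e, e \notin J} ->
    mean p s (fun g => (walk k v (J :|: g))%:R) <= surv (wt s J) k [::] v.
  apply: (@le_trans _ _ (surv (wt s set0) k [::] v)).
    rewrite -(@eq_mean _ _ p s (fun g => (walk k v (set0 :|: g))%:R)); last first.
      by move=> g; rewrite set0U.
    by apply: main => e _; rewrite inE.
  by apply: surv_le => // e; rewrite /wt inE; case: ifP; rewrite ?p0 lexx.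
elim: s us J => [|e s IHs] /= us J dJ.
  rewrite setU0; case: (boolP (walk k v J)) => [/existsP[t /andP[ut /allP tJ]]|_].
    rewrite (walk_surv (s := t)) ?size_tuple // => e et.
    by have eJ : e \in J := tJ _ et; rewrite /wt eJ.
  by case/andP: (surv01 k [::] v (wt01 [::] J)).
move: us => /andP[es us].
have [_] := surv_concave k [::] v e (wt01 (e :: s) J).
have eJ := dJ e (mem_head _ _).
rewrite (eq_surv (w := upd _ e 0) (w' := wt s J)); last first.
  move=> x; rewrite /upd /wt inE; case: eqP => //= ->.
  by rewrite (negbTE es) (negbTE eJ).
rewrite (eq_surv (w := upd _ e 1) (w' := wt s (e |: J))); last first.
  move=> x; rewrite /upd /wt !inE; case: eqP => //= ->.
  by rewrite (negbTE es).
have -> : wt (e :: s) J e = p by rewrite /wt mem_head.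
apply: le_trans; apply: lerD.
  apply: ler_wpM2l; rewrite ?subr_ge0 //; apply: IHs => // x xs.
  by apply: dJ; rewrite inE xs orbT.
apply: ler_wpM2l => //.
rewrite (@eq_mean _ _ p s _ (fun g => (walk k v ((e |: J) :|: g))%:R)); last first.
  by move=> g; rewrite setUCA setUA.
apply: IHs => // x xs; rewrite !inE negb_or dJ ?inE ?xs ?orbT // andbT.
by apply: contraNneq es => <-.
Qed.

End Survival.

(** * Decay of the survival probability *)

Section Bound.
Variable R : realFieldType.

(** The right side agrees with the left to second order in x. The union bound (n+1)x would give no
    decay; the quadratic correction does. *)
Lemma one_minus_expn_le (x : R) n : 0 <= x <= 1 ->
  1 - (1 - x) ^+ n.+1 <= 2 * n.+1%:R * x / (2 + n%:R * x).
Proof.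
move=> /andP[x0 x1]; elim: n => [|n IHn].
  by rewrite expr1 mul0r addr0; lra.
have n0 : 0 <= n%:R :> R by [].
have d1 : 0 < 2 + n%:R * x by rewrite ltr_wpDr // mulr_ge0.
have d2 : 0 < 2 + n.+1%:R * x by rewrite ltr_wpDr // mulr_ge0.
rewrite exprS.
apply: (@le_trans _ _ (x + (1 - x) * (2 * n.+1%:R * x / (2 + n%:R * x)))).
  have : (1 - x) * (1 - (1 - x) ^+ n.+1) <=
      (1 - x) * (2 * n.+1%:R * x / (2 + n%:R * x)).
    by rewrite ler_wpM2l // subr_ge0.
  by lra.
rewrite mulrA ler_pdivlMr //.
have -> : (x + (1 - x) * (2 * n.+1%:R * x) / (2 + n%:R * x)) * (2 + n.+1%:R * x) =
   (x * (2 + n%:R * x) + (1 - x) * (2 * n.+1%:R * x)) * (2 + n.+1%:R * x) /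
   (2 + n%:R * x).
  by field; rewrite gt_eqF.
rewrite ler_pdivrMr //.
rewrite -[n.+2%:R]natr1 -[n.+1%:R]natr1.
have : 0 <= x ^+ 3 * ((n%:R + 1) * (n%:R + 1)) .
  by rewrite !mulr_ge0 ?exprn_ge0 ?addr_ge0.
have : 0 <= x ^+ 3 * ((n%:R + 1) ).
  by rewrite !mulr_ge0 ?exprn_ge0 ?addr_ge0.
nra.
Qed.

(** With y = np, one generation gives 1/q' >= 1/(yq) + 1/4. At y = 1 this yields q <= 4/k; a mean up
    to L costs a factor L per generation. *)
Lemma survival_bound_le (p L : R) n k : 0 <= p <= 1 -> (1 < n)%N ->
  n%:R * p <= L -> 1 <= L ->
  survival_bound p n k.+1 * k.+1%:R <= 4 * L ^+ k.+1.
Proof.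
move=> p01 n1 npL L1; have /andP[p0 p1] := p01.
elim: k => [|k IHk].
  rewrite mulr1 expr1; have /andP[_ ?] := survival_bound01 n 1 p01.
  by lra.
have /andP[q0 q1] := survival_bound01 n k.+1 p01.
set q := survival_bound p n k.+1 in IHk q0 q1 *.
have -> : survival_bound p n k.+2 = 1 - (1 - p * q) ^+ n by [].
clearbody q.
set B := L ^+ k.+1 in IHk *.
have B1 : 1 <= B by rewrite exprn_ege1.
rewrite exprS -/B.
case: n n1 npL => [//|[//|n]] _ npL.
have pq : 0 <= p * q <= 1 by apply/andP; nra.
apply: (@le_trans _ _ (2 * n.+2%:R * (p * q) / (2 + n.+1%:R * (p * q)) * k.+2%:R)).
  by rewrite ler_wpM2r // one_minus_expn_le.
set y := n.+2%:R * p in npL.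
have y0 : 0 <= y by rewrite mulr_ge0.
(* With N >= 2 vertices, N <= 2(N-1); this bounds the denominator below by 2 + yq/2. *)
have yn : y <= 2 * (n.+1%:R * p).
  rewrite /y -[n.+2%:R]natr1 -[n.+1%:R]natr1.
  have : 0 <= n%:R * p by rewrite mulr_ge0.
  by nra.
have d : 0 < 2 + n.+1%:R * (p * q).
  by rewrite ltr_wpDr // !mulr_ge0.
rewrite mulrAC ler_pdivrMr //.
have -> : 2 * n.+2%:R * (p * q) * k.+2%:R = 2 * (y * q) * k.+2%:R by rewrite /y; ring.
apply: (@le_trans _ _ (4 * (L * B) * (2 + y * q / 2))); last first.
  rewrite ler_wpM2l ?mulr_ge0 //; [lra|lra|].
  have : y * q <= 2 * (n.+1%:R * p) * q by rewrite ler_wpM2r.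
  by lra.
(* Of the k+2 copies of 2yq, the induction hypothesis pays k+1 with 8LB; the last is at most 2LByq
   since LB >= 1. *)
have yqB : y * q * k.+1%:R <= L * (4 * B).
  by rewrite -mulrA ler_pM // mulr_ge0.
rewrite -[k.+2%:R]natr1.
have : y * q <= L * B * (y * q).
  have : 1 <= L * B by nra.
  have : 0 <= y * q by rewrite mulr_ge0.
  by nra.
lra.
Qed.

End Bound.

(** * Middle edges of a long saop *)

Section LongSaop.
Variable n : nat.
Implicit Types (g : digraph n) (v : 'I_n) (s : seq 'I_n).

Definition out_arc v (x : 'I_n) := (v, x).
Definition in_arc v (x : 'I_n) := (x, v).

Lemma labels_out v s : labels out_arc v s = arcs v s.
Proof. by elim: s v => //= x s IHs v; rewrite IHs. Qed.

Lemma arcs_cat v s1 s2 : arcs v (s1 ++ s2) = arcs v s1 ++ arcs (last v s1) s2.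
Proof. by elim: s1 v => //= x s1 IHs v; congr cons; exact: IHs. Qed.

Lemma labels_rcons (V E : finType) (arc : V -> V -> E) (v x : V) (s : seq V) :
  labels arc v (rcons s x) = rcons (labels arc v s) (arc (last v s) x).
Proof. by elim: s v => //= y s IHs v; rewrite IHs. Qed.

(** Reversal turns the part of a saop before a middle edge into a walk for [in_arc]. *)
Lemma labels_in v s :
  labels in_arc (last v s) (rev (belast v s)) = rev (arcs v s).
Proof.
elim: s v => [//|x s IHs] v.
have -> : arcs v (x :: s) = (v, x) :: arcs x s by [].
rewrite /= !rev_cons labels_rcons IHs; congr rcons; congr (v, _).
have -> : last (last x s) (rev (belast x s)) = last v (rev (x :: s)).
  by rewrite lastI rev_rcons.
by rewrite rev_cons last_rcons.
Qed.

(** The nesting allows the van den Berg-Kesten inequality to be applied twice, giving one factor for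
    the edge and one for each trail. *)
Definition middle k (e : 'I_n * 'I_n) : pred (digraph n) :=
  disjoint_occurrence (fun g => e \in g)
    (disjoint_occurrence (walk in_arc k e.1) (walk out_arc k e.2)).

Lemma saop_middle g v s1 w s2 k : saop g v (s1 ++ w :: s2) ->
  (k <= size s1)%N -> (k <= size s2)%N -> middle k (last v s1, w) g.
Proof.
set e := (last v s1, w).
have -> : saop g v (s1 ++ w :: s2) =
    uniq (arcs v s1 ++ e :: arcs w s2) && all (mem g) (arcs v s1 ++ e :: arcs w s2).
  by rewrite /saop arcs_cat.
move=> /andP[]; rewrite -[e :: _]cat1s uniq_catCA cat1s cons_uniq => /andP[].
rewrite mem_cat negb_or => /andP[e1 e2].
rewrite cat_uniq => /and3P[u1 /hasPn u12 u2] /allP sg ks1 ks2.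
pose a := [set x in arcs v s1]%SET; pose b := [set x in arcs w s2]%SET.
apply/existsP; exists [set e]%SET; apply/existsP; exists (a :|: b)%SET.
apply/and3P; split.
- by rewrite disjoints_subset sub1set !inE negb_or e1 e2.
- apply/fintype.subsetP => x; rewrite !inE => xab; apply: sg.
  by rewrite mem_cat inE orbCA.
rewrite set11 /=; apply/existsP; exists a; apply/existsP; exists b.
apply/and3P; split => //.
- rewrite disjoint_sym disjoints_subset; apply/fintype.subsetP => x.
  by rewrite !inE => /u12.
- apply/andP; split.
    apply: (@walkP _ _ _ _ _ _ (rev (belast v s1))).
    + by rewrite size_rev size_belast.
    + by rewrite labels_in rev_uniq.
    + by move=> x; rewrite labels_in mem_rev inE.
  apply: (@walkP _ _ _ _ _ _ s2) => //; rewrite labels_out // => x.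
  by rewrite inE.
Qed.

(** The arcs at positions k to k+m-1 are pairwise different, and each has at least k arcs of the
    saop on either side. *)
Lemma card_middle g v s k m (D : digraph n) : g \subset D -> saop g v s ->
  (k + m + k <= size s)%N -> (m <= #|[set e in D | middle k e g]%SET|)%N.
Proof.
move=> gD sg kmk; pose r := take m (drop k (arcs v s)).
have szr : size r = m.
  rewrite size_takel // size_drop size_arcs leq_subRL; last first.
    by apply: leq_trans kmk; rewrite -addnA leq_addr.
  by apply: leq_trans kmk; rewrite leq_addr.
have /andP[us sgs] := sg.
rewrite -szr cardE; apply: uniq_leq_size; first by rewrite take_uniq // drop_uniq.
move=> e /(nthP e)[i]; rewrite szr => im.
rewrite nth_take // nth_drop => ei; rewrite mem_enum inE.
have kis : (k + i < size s)%N.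
  by apply: leq_trans kmk; rewrite -addnS -addnA leq_add2l (leq_trans im) // leq_addr.
have es : e \in arcs v s by rewrite -ei mem_nth // size_arcs.
rewrite (fintype.subsetP gD) /=; last exact: (allP sgs) es.
have sE : s = take (k + i) s ++ nth v s (k + i) :: drop (k + i).+1 s.
  by rewrite -drop_nth // cat_take_drop.
have -> : e = (last v (take (k + i) s), nth v s (k + i)).
  rewrite -ei [in arcs v s]sE arcs_cat nth_cat size_arcs size_takel; last exact: ltnW.
  by rewrite ltnn subnn.
apply: (saop_middle (s2 := drop (k + i).+1 s)); first by rewrite -sE.
  by rewrite size_takel ?leq_addr // ltnW.
rewrite size_drop leq_subRL //; apply: leq_trans kmk.
by rewrite -addnS -addnA -addnA leq_add2l leq_add2r.
Qed.

Lemma mean_longest_saop (R : realFieldType) (p : R) k m (D : digraph n) :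
  (0 < n)%N -> 0 <= p <= 1 ->
  m%:R * mean p (enum D) (fun g => ((k + m + k <= longest_saop g)%N)%:R) <=
  n%:R ^+ 2 * (p * survival_bound p n k ^+ 2).
Proof.
move=> n0 p01; have /andP[p0 p1] := p01.
have uD := enum_uniq D.
have /andP[q0 q1] := survival_bound01 n k p01.
apply: (@le_trans _ _ (mean p (enum D) (fun g => \sum_(e in D) (middle k e g)%:R))).
  rewrite -meanZ; apply: mean_le => // g gD.
  have gsD : g \subset D by apply/fintype.subsetP => e /gD; rewrite mem_enum.
  have [v [s [gs sl]]] := longest_saop_attained g n0.
  case: leqP => [km|_]; last by rewrite mulr0 sumr_ge0.
  rewrite mulr1 -natr_sum ler_nat -big_mkcondr sum1_card /=.
  rewrite -sl in km; apply: leq_trans (card_middle gsD gs km) _.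
  by rewrite cardsE.
rewrite mean_sum.
apply: (@le_trans _ _ (\sum_(e in D) p * survival_bound p n k ^+ 2)).
  apply: ler_sum => e eD.
  have memi : increasing (fun g : digraph n => e \in g).
    by move=> g h /fintype.subsetP/(_ e).
  apply: le_trans (mean_disjoint_occurrence p01 uD memi _) _.
    exact: disjoint_occurrence_increasing.
  rewrite mean_mem ?mem_enum //; apply: ler_wpM2l => //.
  apply: le_trans (mean_disjoint_occurrence p01 uD (@walk_increasing _ _ _ _ _)
    (@walk_increasing _ _ _ _ _)) _.
  rewrite expr2; apply: ler_pM; rewrite ?mean_ge0 //;
    by apply: le_trans (mean_walk _ _ _ p01 uD) _; rewrite card_ord.
rewrite sumr_const -[leLHS]mulr_natl ler_wpM2r ?mulr_ge0 ?sqr_ge0 //.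
rewrite -natrX ler_nat; apply: leq_trans (max_card _) _.
by rewrite card_prod card_ord mulnn.
Qed.

End LongSaop.

Local Open Scope classical_set_scope.
Local Open Scope ring_scope.

(** * From the law of the random digraph to [mean] *)

Section Law.
Context {d : measure_display} {T : measurableType d} {R : realType}.
Variables (P : probability T R) (n : nat) (p : R) (G : T -> digraph n).
Hypothesis G_law : is_binomial_digraph P p G.

(** Independence is stated for presence of edges only. Carrying a set [J] of edges forced to be
    present lets absence be treated by subtraction. *)
Lemma probability_meanI (s : seq ('I_n * 'I_n)) (J : digraph n) (X : pred (digraph n)) :
  uniq s -> {subset s <= possible_edges n} -> J \subset possible_edges n ->
  {in s, forall e, e \notin J} ->
  P [set w | J \subset G w /\ X [set e in G w | e \in s]%SET] =
  (p ^+ #|J| * mean p s (fun g => (X g)%:R))%:E.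
Proof.
have [_ Gp [_ Gind]] := G_law.
elim: s J X => [|e s IHs] J X /=.
  move=> _ _ JD _.
  have G0 w : [set e in G w | e \in [::]]%SET = finset.set0.
    by apply/setP => e; rewrite !inE andbF.
  case: (boolP (X finset.set0)) => X0.
    rewrite mulr1 -prodr_const -prodEFin.
    transitivity (P (\bigcap_(i in [set` J]) [set w | i \in G w])).
      congr (P _); apply/seteqP; split => w /=.
        by move=> [/fintype.subsetP JG _] i /JG.
      move=> JG; split; last by rewrite G0.
      by apply/fintype.subsetP => i iJ; exact: JG.
    rewrite Gind //; apply: eq_bigr => i iJ.
    by rewrite Gp // (fintype.subsetP JD).
  rewrite mulr0; rewrite (_ : [set w | _] = classical_sets.set0) ?measure0 //.
  by apply/seteqP; split => // w /= [_]; rewrite G0 (negbTE X0).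
move=> /andP[es us] sD JD sJ.
have eJ : e \notin J by apply: sJ; rewrite mem_head.
have sD' : {subset s <= possible_edges n}.
  by move=> x xs; apply: sD; rewrite inE xs orbT.
have sJ' : {in s, forall x, x \notin J}.
  by move=> x xs; apply: sJ; rewrite inE xs orbT.
have eJD : (e |: J)%SET \subset possible_edges n.
  by apply/fintype.subsetP => x; rewrite in_setU1 => /predU1P[->|/(fintype.subsetP JD)//];
    rewrite sD ?mem_head.
have seJ : {in s, forall x, x \notin (e |: J)%SET}.
  move=> x xs; rewrite in_setU1 negb_or sJ' // andbT.
  by apply: contraNneq es => <-.
pose ev (K : digraph n) (Y : pred (digraph n)) :=
  [set w | K \subset G w /\ Y [set x in G w | x \in s]%SET].
have Pev (K : digraph n) (Y : pred (digraph n)) : K \subset possible_edges n -> {in s, forall x, x \notin K} ->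
    P (ev K Y) = (p ^+ #|K| * mean p s (fun g => (Y g)%:R))%:E.
  exact: IHs.
have mev K Y : measurable (ev K Y).
  exact: (measurable_binomial_digraph
    [set g : digraph n | K \subset g /\ Y [set x in g | x \in s]%SET] G_law).
have eG w : e \in G w -> [set x in G w | x \in e :: s]%SET =
    (e |: [set x in G w | x \in s])%SET.
  by move=> ew; apply/setP => x; rewrite !inE andb_orr; case: eqP => [->|_]; rewrite ?ew ?andbF.
have eGN w : e \notin G w -> [set x in G w | x \in e :: s]%SET =
    [set x in G w | x \in s]%SET.
  move=> ew; apply/setP => x; rewrite !inE andb_orr; case: eqP => [->|_]; rewrite ?andbF //.
  by rewrite (negbTE ew).
have UJG w : ((e |: J)%SET \subset G w) = (e \in G w) && (J \subset G w).
  by rewrite subUset sub1set.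
(* Split on whether [e] is present; its absence is the event for [J] minus the event for [J] with
   [e] added. *)
have -> : [set w | J \subset G w /\ X [set x in G w | x \in e :: s]%SET] =
    ev (e |: J)%SET (fun g => X (e |: g)%SET) `|` (ev J X `\` ev (e |: J)%SET X).
  rewrite /ev; apply/seteqP; split => w /=.
    move=> [JG XG]; rewrite UJG JG andbT; have [ew|ew] := boolP (e \in G w).
      by left; split => //; rewrite -eG.
    right; split; last by case.
    by split => //; rewrite -eGN.
  rewrite UJG => -[[/andP[ew JG] XG]|[[JG XG] N]]; split => //; first by rewrite eG.
  rewrite eGN //; apply/negP => ew; apply: N; split => //; by rewrite ew JG.
set A := ev (e |: J)%SET (fun g => X (e |: g)%SET).
have -> : P (A `|` (ev J X `\` ev (e |: J)%SET X)) =
    (P A + (P (ev J X) - P (ev (e |: J)%SET X)))%E.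
  rewrite measureU; [|exact: mev|exact: measurableD|].
    rewrite measureD //; last by rewrite ltey_eq fin_num_measure.
    congr (_ + (_ - P _))%E; rewrite /ev; apply/seteqP; split => w /=; first by case.
    by rewrite UJG => -[/andP[ew JG] XG]; split; split => //; rewrite ew.
  rewrite /A /ev; apply/seteqP; split => // w /= [[+ _] [[JG XG] N]].
  by rewrite UJG => /andP[ew _]; apply: N; rewrite UJG ew.
rewrite !Pev // cardsU1 eJ -EFinB -EFinD exprS; congr EFin.
by ring.
Qed.

Lemma probability_mean (X : pred (digraph n)) :
  P [set w | X (G w)] = (mean p (enum (possible_edges n)) (fun g => (X g)%:R))%:E.
Proof.
have := @probability_meanI (enum (possible_edges n)) finset.set0 X (enum_uniq _).
rewrite cards0 expr0 mul1r => <-; last 3 first.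
- by move=> e; rewrite mem_enum.
- exact: sub0set.
- by move=> e _; rewrite inE.
have [Gsub _ _] := G_law.
congr (P _); apply/seteqP; split => w /=; rewrite (_ : [set e in G w | _]%SET = G w).
- by move=> XG; split => //; exact: sub0set.
- apply/setP => e; rewrite inE mem_enum andb_idr //; exact: (fintype.subsetP (Gsub w)).
- by case.
- apply/setP => e; rewrite inE mem_enum andb_idr //; exact: (fintype.subsetP (Gsub w)).
Qed.

End Law.

(** * Tightness at scale n^(1/3) *)

Lemma longest_saop_le n (g : digraph n) : (0 < n)%N -> (longest_saop g <= n ^ 2)%N.
Proof.
move=> n0; have [v [s [gs <-]]] := longest_saop_attained g n0.
apply: leq_trans (saop_size gs) _; apply: leq_trans (max_card _) _.
by rewrite card_prod card_ord.
Qed.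

(** Since k <= 2r, (1 + c/r)^k <= exp(2c), so q <= 4 exp(2c)/r. Then n^2 p q^2 / m is at most (np)(4
    exp(2c))^2 n/(A r^3), and r^3 = n cancels the remaining power of n. *)
Lemma critical_window_bound (R : realType) (n k m : nat) (p c r A : R) :
  (1 < n)%N -> 0 <= p <= 1 -> 0 <= c -> 1 <= r -> r ^+ 3 = n%:R -> 0 < A ->
  n%:R * p <= 1 + c / r -> r <= k%:R <= 2 * r -> A * r <= m%:R ->
  mean p (enum (possible_edges n)) (fun g => ((k + m + k <= longest_saop g)%N)%:R)
    <= 16 * (1 + c) * expR (2 * c) ^+ 2 / A.
Proof.
move=> n1 p01 c0 r1 r3 A0 np /andP[rk kr] Am; have /andP[p0 p1] := p01.
have n0 : (0 < n)%N by exact: ltnW.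
have r0 : 0 < r by lra.
have m0 : 0 < m%:R :> R by apply: lt_le_trans Am; rewrite mulr_gt0.
have := mean_longest_saop k m (possible_edges n) n0 p01.
set x := mean _ _ _; set q := survival_bound p n k => mx.
have /andP[q0 q1] : 0 <= q <= 1 := survival_bound01 n k p01.
have cr0 : 0 <= c / r by rewrite divr_ge0 // ltW.
have crc : c / r <= c by rewrite ler_pdivrMr // ler_peMr.
have qr : q * r <= 4 * expR (2 * c).
  apply: (@le_trans _ _ (q * k%:R)); first by rewrite ler_wpM2l.
  have k0 : (0 < k)%N by rewrite -(ltr_nat R); lra.
  rewrite /q -(prednK k0).
  apply: le_trans (survival_bound_le _ p01 n1 np _) _; first by lra.
  rewrite (prednK k0) ler_wpM2l //.
  apply: (@le_trans _ _ (expR (c / r) ^+ k)).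
    by rewrite lerXn2r ?nnegrE ?expR_ge0 ?expR_ge1Dx //; lra.
  rewrite -expRM_natl ler_expR.
  apply: (@le_trans _ _ ((2 * r) * (c / r))); first by rewrite ler_wpM2r.
  by rewrite [leLHS](_ : _ = 2 * c) //; field; rewrite gt_eqF.
rewrite ler_pdivlMr //.
have x0 : 0 <= x by apply: mean_ge0.
set Ex := expR _ in qr *.
have E0 : 0 <= Ex by exact: expR_ge0.
rewrite -(@ler_pM2r _ (r ^+ 3)) ?exprn_gt0 //.
apply: (@le_trans _ _ (m%:R * x * r ^+ 2)).
  have -> : x * A * r ^+ 3 = (A * r) * x * r ^+ 2 by ring.
  by rewrite ler_wpM2r ?sqr_ge0 // ler_wpM2r.
apply: (@le_trans _ _ (n%:R ^+ 2 * (p * q ^+ 2) * r ^+ 2)).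
  by rewrite ler_wpM2r ?sqr_ge0.
rewrite r3.
have -> : n%:R ^+ 2 * (p * q ^+ 2) * r ^+ 2 = (n%:R * p) * (q * r) ^+ 2 * n%:R by ring.
rewrite ler_wpM2r //.
have -> : 16 * (1 + c) * Ex ^+ 2 = (1 + c) * (4 * Ex) ^+ 2 by ring.
apply: ler_pM; [exact: mulr_ge0|exact: sqr_ge0|lra|].
by rewrite lerXn2r ?nnegrE ?mulr_ge0 // ltW.
Qed.

Theorem theorem2 (R : realType) (p : nat -> R)
    (p01 : forall n : nat, (0 < n)%N -> 0 <= p n <= 1)
    (pO : (fun n : nat => p n - n%:R^-1) =O_\oo
          (fun n : nat => n%:R `^ (- (4 / 3)) : R))
    (d : nat -> measure_display) (T : forall n : nat, measurableType (d n))
    (P : forall n : nat, probability (T n) R)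
    (G : forall n : nat, T n -> digraph n)
    (G_law : forall n : nat, (0 < n)%N ->
       is_binomial_digraph (P n) (p n) (@G n)) :
  bigO_in_probability P
    (fun (n : nat) (w : T n) => (longest_saop (G n w))%:R)
    (fun n : nat => n%:R `^ (1 / 3)).
Proof.
move: pO => /eqO_exP[c c0 [N _ pN]].
have powN (n : nat) : (0 < n)%N ->
    n%:R * n%:R `^ (- (4 / 3)) = (n%:R `^ (1 / 3))^-1 :> R.
  move=> n0; rewrite -powRN -{1}[n%:R]powRr1 // -powRD.
    by congr (_ `^ _); lra.
  by rewrite pnatr_eq0 -lt0n n0 implybT.
move=> eps eps0.
(* Chosen so that the bound of [critical_window_bound] equals eps. *)
pose A := 16 * (1 + c) * expR (2 * c) ^+ 2 / eps.
have A0 : 0 < A by rewrite !mulr_gt0 ?invr_gt0 ?exprn_gt0 ?expR_gt0 //; lra.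
pose N1 := maxn N 2.
have N10 : 0 <= (N1 ^ 2)%:R :> R by [].
(* For large n, 2k <= 4r and m <= Ar + 1 <= (A+1)r, hence A + 5. The term N1^2 makes the event empty
   for n < N1, by [longest_saop_le]. *)
exists (A + 5 + (N1 ^ 2)%:R) => n n0.
set r : R := n%:R `^ (1 / 3).
have r3 : r ^+ 3 = n%:R.
  by rewrite -powR_mulrn ?powR_ge0 // -powRrM mul1r mulVf // powRr1.
have r1 : 1 <= r.
  rewrite -(powRr0 n%:R) /r; apply: ler_powR; last by lra.
  by rewrite (ler_nat _ 1).
have r0 : 0 < r by lra.
have absE (x : nat) : `|x%:R / r| = x%:R / r :> R by rewrite ger0_norm // divr_ge0 // ltW.
have [nN|Nn] := ltnP n N1.
  rewrite (_ : [set w | _] = classical_sets.set0) ?measure0 ?lee_fin ?ltW //.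
  apply/seteqP; split => // w /=; rewrite absE ltNge => /negP; apply.
  rewrite ler_pdivrMr //.
  have h : (longest_saop (G n w))%:R <= (N1 ^ 2)%:R :> R.
    rewrite ler_nat (leq_trans (longest_saop_le _ n0)) // leq_sqr; exact: ltnW.
  by nra.
have [NN N2] : (N <= n)%N /\ (1 < n)%N by move: Nn; rewrite geq_max => /andP[].
have np : n%:R * p n <= 1 + c / r.
  have n0' : 0 < n%:R :> R by rewrite ltr0n.
  have := pN n NN => /=; rewrite [X in _ <= _ * X]ger0_norm ?powR_ge0 // => /ler_normlW.
  rewrite lerBlDr => /(ler_wpM2l (ltW n0')).
  by rewrite mulrDr divff ?gt_eqF // mulrCA powN // addrC.
(* The successor makes k and m exceed r and Ar, while r >= 1 keeps k below 2r. *)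
pose k := (Num.truncn r).+1; pose m := (Num.truncn (A * r)).+1.
have /andP[kr rk] := truncn_itv (ltW r0).
have /andP[mr rm] := truncn_itv (ltW (mulr_gt0 A0 r0)).
have kr2 : k%:R <= 2 * r by rewrite /k -natr1; lra.
have mr2 : m%:R <= A * r + 1 by rewrite /m -natr1; lra.
apply: (@le_trans _ _ (P n [set w | (k + m + k <= longest_saop (G n w))%N])).
  apply: le_measure.
  - apply: mem_set; exact: (measurable_binomial_digraph [set g : digraph n |
      A + 5 + (N1 ^ 2)%:R < `|(longest_saop g)%:R / r|] (G_law n n0)).
  - apply: mem_set; exact: (measurable_binomial_digraph [set g : digraph n |
      (k + m + k <= longest_saop g)%N] (G_law n n0)).
  move=> w /=; rewrite absE ltr_pdivlMr // => Lw.
  rewrite -(ler_nat R) !natrD; nra.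
rewrite (probability_mean (G_law n n0) (fun g => k + m + k <= longest_saop g)%N) lee_fin.
apply: le_trans (critical_window_bound N2 (p01 n n0) (ltW c0) r1 r3 A0 np _ (ltW rm)) _.
  by rewrite (ltW rk).
rewrite /A; set z := 16 * _ * _.
by rewrite invf_div mulrC divfK // gt_eqF // !mulr_gt0 ?exprn_gt0 ?expR_gt0 //; lra.
Qed.
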